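(* Let $a<b$ be real numbers with $[a,b]\subset\mathbb{R}\setminus\{0\}$. Let $h:J\to[0,\infty)$ with $(0,1)\subseteq J\subset\mathbb{R}$, $h$ not identically $0$, $h$ integrable on $[0,1]$ and $h(1/2)\neq 0$. Let $f:[a,b]\to[0,\infty)$ be integrable and symmetrized harmonic $h$-convex on $[a,b]$. Then for all $x,y\in[a,b]$ with $x\ne y$, $$\frac{1}{4h(\frac12)}\left[f\left(\frac{2xy}{x+y}\right)+f\left(\frac{2abxy}{2xy(a+b)-ab(x+y)}\right)\right]\le\frac{xy}{2(y-x)}\left[\int_x^y\frac{f(t)}{t^2}\,dt+\int_{\frac{aby}{(a+b)y-ab}}^{\frac{abx}{(a+b)x-ab}}\frac{f(t)}{t^2}\,dt\right]$$ $$\le\frac12\left[f(x)+f\left(\frac{abx}{(a+b)x-ab}\right)+f(y)+f\left(\frac{aby}{(a+b)y-ab}\right)\right]\int_0^1h(t)\,dt.$$ In particular, $$\frac{1}{2h(\frac12)}f\left(\frac{2ab}{a+b}\right)\le\frac{ab}{b-a}\int_a^b\frac{f(t)}{t^2}\,dt\le[f(a)+f(b)]\int_0^1h(t)\,dt.$$ If instead $f$ is symmetrized harmonic $h$-concave on $[a,b]$ (all other hypotheses being the same), all of these inequalities hold with $\le$ replaced by $\ge$.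
   Context: Let $h:J\to[0,\infty)$ with $(0,1)\subseteq J\subset\mathbb{R}$, $h$ not identically $0$. For an interval $I\subset\mathbb{R}\setminus\{0\}$, a function $g:I\to[0,\infty)$ is harmonic $h$-convex on $I$ if for all $x,y\in I$ and all $t\in(0,1)$, $g\left(\frac{xy}{tx+(1-t)y}\right)\le h(t)g(y)+h(1-t)g(x)$; it is harmonic $h$-concave if the reverse inequality always holds. For $f$ on $[a,b]\subset\mathbb{R}\setminus\{0\}$, the symmetrical transform of $f$ on $[a,b]$ is $\breve f(t)=\frac12\left[f(t)+f\left(\frac{abt}{(a+b)t-ab}\right)\right]$, $t\in[a,b]$. The function $f$ is symmetrized harmonic $h$-convex (concave) on $[a,b]$ if $\breve f$ is harmonic $h$-convex (concave) on $[a,b]$. Integrals are oriented: $\int_u^v=-\int_v^u$. *)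

(* Defs.v *)
From mathcomp Require Export all_boot all_order all_algebra.
From mathcomp Require Export all_classical all_reals all_analysis.

Set Implicit Arguments.
Unset Strict Implicit.
Unset Printing Implicit Defensive.

Import Order.TTheory GRing.Theory Num.Theory.

Local Open Scope classical_set_scope.
Local Open Scope ring_scope.

(* A function on a subset of R is represented by a total function whose values
   outside that subset are irrelevant.  Integrability and integrals refer to
   Lebesgue measure on the Lebesgue (completed Borel) sigma-algebra, so that
   functions that are Lebesgue but not Borel measurable are covered. *)

Definition lebesgue_integrable (R : realType) (D : set R) (f : R -> R) : Prop :=
  (@completed_lebesgue_measure R).-integrable D (EFin \o f).

Definition lebesgue_int (R : realType) (f : R -> R) (u v : R) : R :=
  if u <= v then \int[@completed_lebesgue_measure R]_(t in `[u, v]) f t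
  else - \int[@completed_lebesgue_measure R]_(t in `[v, u]) f t.

Definition harmonic_h_convex (R : realType) (h : R -> R) (I : set R)
    (g : R -> R) : Prop :=
  forall x y t : R, I x -> I y -> 0 < t < 1 ->
    g (x * y / (t * x + (1 - t) * y)) <= h t * g y + h (1 - t) * g x.

Definition harmonic_h_concave (R : realType) (h : R -> R) (I : set R)
    (g : R -> R) : Prop :=
  forall x y t : R, I x -> I y -> 0 < t < 1 ->
    g (x * y / (t * x + (1 - t) * y)) >= h t * g y + h (1 - t) * g x.

(* The involution of [a, b] given by 1 / harm_refl a b t = 1/a + 1/b - 1/t. *)
Definition harm_refl (R : realType) (a b t : R) : R :=
  a * b * t / ((a + b) * t - a * b).

Definition symm_transform (R : realType) (a b : R) (f : R -> R) : R -> R :=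
  fun t => 2^-1 * (f t + f (harm_refl a b t)).

Definition symm_harmonic_h_convex (R : realType) (h : R -> R) (a b : R)
    (f : R -> R) : Prop :=
  harmonic_h_convex h `[a, b] (symm_transform a b f).

Definition symm_harmonic_h_concave (R : realType) (h : R -> R) (a b : R)
    (f : R -> R) : Prop :=
  harmonic_h_concave h `[a, b] (symm_transform a b f).

(* Main.v *)
From HB Require Import structures.
From mathcomp Require Import measurable_realfun ring lra.
Require Import Defs.
Import Order.TTheory GRing.Theory Num.Theory.
Import numFieldNormedType.Exports.
Local Open Scope classical_set_scope.
Local Open Scope ring_scope.

(** Write p = 1/u, under which a harmonic h-convex function becomes an
    h-convex function of p, the harmonic segment from [x] to [y] becomes the
    straight segment from 1/x to 1/y, the weight 1/u^2 becomes constant, and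
    the reflection [harm_refl a b] becomes p |-> 1/a + 1/b - p.

    Hence, for phi t = x y / (t x + (1 - t) y) on [0, 1] and F the symmetrical
    transform of f, two facts suffice.

    - The middle term of the inequality is exactly the integral of F o phi over
      [0, 1] ([symm_mean_identity]).  Both of its integrals become integrals
      over [0, 1] by substituting a harmonic segment
      ([integral_harmonic_segment]); the second one runs from the reflection
      of y to the reflection of x, and the reflection carries harmonic
      segments to harmonic segments ([harm_refl_segment]), so that it is the
      integral of f o harm_refl o phi up to the change t |-> 1 - t, which
      preserves integrals over [0, 1].

    - g = F o phi satisfies g t <= h t F(y) + h (1 - t) F(x), and, F being
      evaluated at the harmonic mean of phi t and phi (1 - t), which is the
      harmonic mean m of x and y, also F(m) <= h (1/2) (g t + g (1 - t)).
      Integrating both over [0, 1] is the Hermite-Hadamard inequality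
      ([hermite_hadamard01]).

    The estimate for [a, b] itself is the case x = a, y = b, since the
    reflection exchanges a and b and fixes their harmonic mean.

    The analytic content is the substitution rule.  As f is only Lebesgue
    integrable, it need be neither continuous nor Borel, and the rule is
    proved for the completed measure ([integral_change_of_variables]): the
    measure A |-> int_(phi^-1 A) w agrees with Lebesgue measure on
    half-lines, by the fundamental theorem of calculus, hence on Borel sets;
    as w > 0, preimages of null sets are null, so that the agreement, together
    with the measurability of preimages, passes to the completion. *)

Set Implicit Arguments.
Unset Strict Implicit.
Unset Printing Implicit Defensive.

Local Notation Borel R := (measurableTypeR R).
Local Notation Leb R := (caratheodory_type (wlength (@idfun R))^*%mu).
Local Notation mu := lebesgue_measure.
Local Notation cmu := completed_lebesgue_measure.

(** * Borel sets and the completed Lebesgue measure *)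

Section completion.
Context {R : realType}.

Lemma borel_lebesgue_measurable (A : set R) :
  measurable (A : set (Borel R)) -> measurable (A : set (Leb R)).
Proof. exact: sub_caratheodory. Qed.

Lemma borel_lebesgue_measurable_fun d (T : measurableType d) (D : set R)
    (f : R -> T) :
  measurable (D : set (Borel R)) ->
  measurable_fun (D : set (Borel R)) (f : Borel R -> T) ->
  measurable_fun (D : set (Leb R)) (f : Leb R -> T).
Proof.
by move=> mD mf _ Y mY; apply: borel_lebesgue_measurable; exact: mf.
Qed.

(** Lebesgue measure is the image of its completion under the identity, seen as
    a measurable map from the larger sigma-algebra to the smaller one. *)
Lemma ge0_integral_completed (D : set R) (f : R -> \bar R) :
  measurable (D : set (Borel R)) ->
  measurable_fun (D : set (Borel R)) (f : Borel R -> \bar R) ->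
  (forall t, D t -> (0 <= f t)%E) ->
  (\int[cmu]_(t in D) f t = \int[mu]_(t in D) f t)%E.
Proof.
move=> mD mf f0.
have mid : measurable_fun setT (idfun : Leb R -> Borel R).
  by move=> _ Y mY; rewrite setTI; exact: borel_lebesgue_measurable.
transitivity (\int[pushforward cmu (idfun : Leb R -> Borel R)]_(t in D) f t)%E.
  by rewrite ge0_integral_pushforward// => t /[!inE]; exact: f0.
by apply: eq_measure_integral.
Qed.

(** The Caratheodory sigma-algebra consists of the unions of a Borel set and a
    negligible set. *)
Lemma lebesgue_measurable_decomp (A : set R) :
  measurable (A : set (Leb R)) ->
  exists B N, [/\ measurable (B : set (Borel R)), measurable (N : set (Borel R)),
    mu N = 0%E & B `<=` A /\ A `<=` B `|` N].
Proof.
rewrite -completed_caratheodory_measurable g_sigma_completed_algebra_genE.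
move=> [/= B mB [N [M [mM M0 NM]] <-]].
exists B, M; split => //; split; first by move=> t; left.
by move=> t [|/NM]; [left|right].
Qed.

End completion.

(** * Change of variables for the completed Lebesgue measure *)

Section change_of_variables.
Context {R : realType}.
Variables (D : set R) (x y : R) (phi w : R -> R).
Hypothesis mD : measurable (D : set (Borel R)).
Hypothesis mphi : measurable_fun (D : set (Borel R)) (phi : Borel R -> Borel R).
Hypothesis phiD : forall t, D t -> `[x, y]%classic (phi t).
Hypothesis mw : measurable_fun (D : set (Borel R)) (w : Borel R -> R).
Hypothesis w_gt0 : forall t, D t -> 0 < w t.
Hypothesis xy : x < y.
(** Agreement on the half-lines starting in [[x, y]] is asked for because it
    covers increasing and decreasing [phi] alike, and is checked by one integral
    of [w] over an interval. *)
Hypothesis ray_mass : forall c, x <= c <= y ->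
  (\int[mu]_(t in D `&` phi @^-1` `[c, +oo[) (w t)%:E = (y - c)%:E)%E.

(** The image under [phi] of the measure of density [w] on [D]; the section
    shows that it is Lebesgue measure on [[x, y]]. *)
Definition weighted_preimage (A : set (Borel R)) : \bar R :=
  (\int[mu]_(t in D `&` phi @^-1` A) (w t)%:E)%E.

Let mpre (A : set R) : measurable (A : set (Borel R)) ->
  measurable (D `&` phi @^-1` A : set (Borel R)).
Proof. by move=> mA; exact: mphi. Qed.

Let mwS (A : set R) :
  measurable_fun (D `&` A : set (Borel R)) (fun t : Borel R => (w t)%:E).
Proof.
apply/measurable_EFinP; apply: measurable_funS mw => //; exact: subIsetl.
Qed.

Let wS_ge0 (A : set R) t : (D `&` A) t -> (0 <= (w t)%:E)%E.
Proof. by move=> [Dt _]; rewrite lee_fin ltW// w_gt0. Qed.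

Let weighted_preimage0 : weighted_preimage set0 = 0%E.
Proof. by rewrite /weighted_preimage preimage_set0 setI0 integral_set0. Qed.

Let weighted_preimage_ge0 A : (0 <= weighted_preimage A)%E.
Proof. by apply: integral_ge0 => t; exact: wS_ge0. Qed.

Let weighted_preimage_sigma_additive : semi_sigma_additive weighted_preimage.
Proof.
move=> F mF tF mUF.
have -> : weighted_preimage (\bigcup_n F n) =
    (\sum_(i <oo) weighted_preimage (F i))%E.
  rewrite /weighted_preimage preimage_bigcup setI_bigcupr.
  apply: ge0_integral_bigcup.
  - by move=> k; exact: mpre.
  - by rewrite -setI_bigcupr; exact: mwS.
  - by move=> t; rewrite -setI_bigcupr; exact: wS_ge0.
  - apply/trivIsetP => i j _ _ ij; apply/seteqP; split => // t [[_ it] [_ jt]].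
    move: tF => /trivIsetP/(_ i j Logic.I Logic.I ij)/seteqP[/(_ (phi t)) + _].
    by apply.
by apply: is_cvg_nneseries => n _ _; exact: weighted_preimage_ge0.
Qed.

HB.instance Definition _ := isMeasure.Build _ _ _ weighted_preimage
  weighted_preimage0 weighted_preimage_ge0 weighted_preimage_sigma_additive.

(** The half-lines [[c, +oo[] form a pi-system that generates the Borel sets, on
    which both measures are finite; a half-line starting outside [[x, y]] meets
    [[x, y]] in nothing or in everything. *)
Lemma weighted_preimageE (A : set R) : measurable (A : set (Borel R)) ->
  weighted_preimage A = mu (A `&` `[x, y]).
Proof.
move=> mA.
have mE : measurable (`[x, y]%classic : set (Borel R)) by [].
have := @measure_unique _ R (Borel R) (@RGenCInfty.G R)
  (fun n => `[- n%:R, +oo[%classic) (@RGenCInfty.measurableE R) _ _ _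
  (mrestr mu mE) weighted_preimage.
move=> /(_ _ _ _ _ _ _ mA) <-//.
- move=> _ _ [a ->] [b ->]; exists (Num.max a b).
  apply/seteqP; split => t /=; rewrite !in_itv/= !andbT ge_max.
    by move=> [-> ->].
  by move=> /andP[].
- by move=> i; exists (- i%:R).
- apply/seteqP; split => // t _; exists (Num.truncn `|t|).+1 => //=.
  rewrite in_itv/= andbT lerNl; apply: ltW.
  by apply: le_lt_trans (truncnS_gt _); rewrite -normrN ler_norm.
- move=> _ [c ->]; rewrite /= /mrestr.
  have [cx|xc] := leP c x.
    have -> : `[c, +oo[%classic `&` `[x, y]%classic = `[x, y]%classic.
      apply/seteqP; split => t /=; rewrite !in_itv/= ?andbT; first by case.
      by move=> /andP[xt ->]; rewrite xt (le_trans cx xt).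
    rewrite lebesgue_measure_itv/= lte_fin xy -EFinB.
    rewrite -ray_mass ?lexx ?ltW// /weighted_preimage; congr integral.
    apply/seteqP; split => t /= [Dt _]; have := phiD Dt;
      rewrite /= !in_itv/= !andbT => /andP[xt _]; split => //.
    exact: le_trans cx xt.
  have [yc|cy] := ltP y c.
    have -> : `[c, +oo[%classic `&` `[x, y]%classic = set0.
      apply/seteqP; split => t //=; rewrite !in_itv/= ?andbT.
      by move=> [ct /andP[_ /(le_trans ct)]]; rewrite leNgt yc.
    rewrite measure0 /weighted_preimage.
    rewrite (_ : _ `&` _ = set0) ?integral_set0//.
    apply/seteqP; split => t //= [Dt]; have := phiD Dt.
    rewrite /= !in_itv/= !andbT => /andP[_ yt] /le_trans/(_ yt).
    by rewrite leNgt yc.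
  rewrite /weighted_preimage ray_mass ?cy ?andbT ?(ltW xc)//.
  have -> : `[c, +oo[%classic `&` `[x, y]%classic = `[c, y]%classic.
    apply/seteqP; split => t /=; rewrite !in_itv/= ?andbT.
      by move=> [-> /andP[_ ->]].
    by move=> /andP[ct ->]; rewrite ct (le_trans (ltW xc) ct).
  rewrite lebesgue_measure_itv/= lte_fin.
  case: ifPn => [_ //|]; rewrite -leNgt => yc.
  have -> : c = y by apply/eqP; rewrite eq_le cy.
  by rewrite subrr.
- move=> k /=; rewrite /mrestr.
  apply: (@le_lt_trans _ _ (mu `[x, y]%classic)).
    by apply: le_measure; rewrite ?inE//; exact: measurableI.
  by rewrite lebesgue_measure_itv/= lte_fin xy ltry.
Qed.

(** The preimage of a null set has zero [w]-mass, and a positive density has zero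
    mass only on null sets. *)
Lemma null_preimage (N : set R) : measurable (N : set (Borel R)) ->
  mu N = 0%E -> mu (D `&` phi @^-1` N) = 0%E.
Proof.
move=> mN N0; have mDN := mpre mN.
have : weighted_preimage N = 0%E.
  apply/eqP; rewrite weighted_preimageE// eq_le measure_ge0 andbT -N0.
  by apply: le_measure; rewrite ?inE//; exact: measurableI.
have -> : weighted_preimage N = (\int[mu]_(t in D `&` phi @^-1` N) `|(w t)%:E|)%E.
  by apply: eq_integral => t /[!inE] /wS_ge0 wt; rewrite gee0_abs.
move/(ae_eq_integral_abs mu mDN (@mwS (phi @^-1` N))) => -[M [mM M0 DM]].
apply/eqP; rewrite eq_le measure_ge0 andbT -M0.
apply: le_measure; rewrite ?inE// => t Dt; apply: DM => /(_ Dt)[].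
by apply/eqP; rewrite gt_eqF// w_gt0//; case: Dt.
Qed.

Lemma preimage_lebesgue_measurable (A : set R) :
  measurable (A : set (Leb R)) -> measurable (D `&` phi @^-1` A : set (Leb R)).
Proof.
move=> /lebesgue_measurable_decomp[B [N [mB mN N0 [BA ABN]]]].
have -> : D `&` phi @^-1` A = (D `&` phi @^-1` B) `|`
    ((D `&` phi @^-1` A) `\` (D `&` phi @^-1` B)).
  by rewrite setDUK// => t [Dt /BA]; split.
apply: measurableU; first by apply: borel_lebesgue_measurable; exact: mpre.
apply: completed_lebesgue_measure_is_complete.
exists (D `&` phi @^-1` N); split.
- by apply: borel_lebesgue_measurable; exact: mpre.
- exact: null_preimage.
- by move=> t [[Dt /ABN[Bt []|Nt _]]].
Qed.

(** Squeeze: a Lebesgue set lies between Borel sets [B] and [B `|` N] with [N]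
    null, and for these the two sides are already known to agree and to have the
    same value. *)
Lemma weighted_preimage_lebesgueE (A : set R) : measurable (A : set (Leb R)) ->
  (\int[cmu]_(t in D `&` phi @^-1` A) (w t)%:E = cmu (A `&` `[x, y]))%E.
Proof.
move=> mA; have mDA := preimage_lebesgue_measurable mA.
have [B [N [mB mN N0 [BA ABN]]]] := lebesgue_measurable_decomp mA.
have mBN : measurable (B `|` N : set (Borel R)) by exact: measurableU.
have mE : measurable (`[x, y]%classic : set (Borel R)) by [].
have borelE (C : set R) : measurable (C : set (Borel R)) ->
    (\int[cmu]_(t in D `&` phi @^-1` C) (w t)%:E = cmu (C `&` `[x, y]))%E.
  move=> mC; rewrite ge0_integral_completed; last first.
  - by move=> t; exact: wS_ge0.
  - exact: mwS.
  - exact: mpre.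
  - exact: weighted_preimageE.
have cmuBN : cmu ((B `|` N) `&` `[x, y]) = cmu (B `&` `[x, y]).
  apply/eqP; rewrite eq_le; apply/andP; split; last first.
    by apply: le_measure; rewrite ?inE; [| |move=> t [? ?]; split => //; by left];
      apply: borel_lebesgue_measurable; exact: measurableI.
  rewrite setIUl; apply: (le_trans (measureU2 _ _ _)).
  - by apply: borel_lebesgue_measurable; exact: measurableI.
  - by apply: borel_lebesgue_measurable; exact: measurableI.
  - rewrite -[leRHS]adde0 leeD2l// -N0.
    by apply: le_measure; rewrite ?inE; [| |exact: subIsetl];
      apply: borel_lebesgue_measurable => //; exact: measurableI.
have mDB := borel_lebesgue_measurable (mpre mB).
have mDBN := borel_lebesgue_measurable (mpre mBN).
have mwDBN : measurable_fun (D `&` phi @^-1` (B `|` N) : set (Leb R))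
    (fun t : Leb R => (w t)%:E).
  by apply: borel_lebesgue_measurable_fun; [exact: mpre|exact: mwS].
have DADBN : D `&` phi @^-1` A `<=` D `&` phi @^-1` (B `|` N).
  by move=> t [Dt /ABN].
have mAE : measurable (A `&` `[x, y] : set (Leb R)).
  by apply: measurableI => //; exact: borel_lebesgue_measurable.
apply/eqP; rewrite eq_le; apply/andP; split.
  apply: (@le_trans _ _ (cmu (B `&` `[x, y]))).
    rewrite -cmuBN -borelE//.
    by apply: (@ge0_subset_integral _ _ _ cmu _ _ mDA mDBN) => // t; exact: wS_ge0.
  apply: le_measure; rewrite ?inE//; last by move=> t [/BA].
  by apply: borel_lebesgue_measurable; exact: measurableI.
apply: (@le_trans _ _ (cmu (B `&` `[x, y]))).
  rewrite -cmuBN; apply: le_measure; rewrite ?inE//; last by move=> t [/ABN].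
  by apply: borel_lebesgue_measurable; exact: measurableI.
rewrite -(borelE B mB); apply: (@ge0_subset_integral _ _ _ cmu _ _ mDB mDA).
- exact: measurable_funS mwDBN.
- by move=> t; exact: wS_ge0.
- by move=> t [Dt /BA].
Qed.

Lemma measurable_fun_preimage d (T : measurableType d) (f : R -> T) :
  measurable_fun (`[x, y]%classic : set (Leb R)) (f : Leb R -> T) ->
  measurable_fun (D : set (Leb R)) (f \o phi : Leb R -> T).
Proof.
move=> mf _ Y mY.
have mE : measurable (`[x, y]%classic : set (Leb R)).
  exact: borel_lebesgue_measurable.
have := preimage_lebesgue_measurable (mf mE Y mY).
congr measurable; apply/seteqP; split => t [Dt].
  by case.
by move=> Yt; split => //; split => //; exact: phiD.
Qed.

Let mE : measurable (`[x, y]%classic : set (Leb R)).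
Proof. exact: borel_lebesgue_measurable. Qed.

Let mDL : measurable (D : set (Leb R)).
Proof. exact: borel_lebesgue_measurable. Qed.

Let mwL : measurable_fun (D : set (Leb R)) (fun t : Leb R => (w t)%:E).
Proof.
by apply: borel_lebesgue_measurable_fun => //; exact/measurable_EFinP.
Qed.

Import HBNNSimple.

(** Both sides are limits, by monotone convergence, of their values on the
    simple functions that approximate [f] from below. *)
Lemma ge0_integral_change_of_variables (f : R -> \bar R) :
  measurable_fun (`[x, y]%classic : set (Leb R)) (f : Leb R -> \bar R) ->
  (forall s, `[x, y]%classic s -> (0 <= f s)%E) ->
  (\int[cmu]_(s in `[x, y]) f s = \int[cmu]_(t in D) (f (phi t) * (w t)%:E))%E.
Proof.
move=> mf f0; pose f_ := nnsfun_approx mE mf.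
have f_cvg s : `[x, y]%classic s -> EFin \o f_^~ s @ \oo --> f s.
  by move=> Es; exact: cvg_nnsfun_approx.
have nd_f_ s : {homo f_^~ s : m n / (m <= n)%N >-> (m <= n)%R}.
  by move=> m n mn; exact/lefP/nd_nnsfun_approx.
have mfphi n : measurable_fun (D : set (Leb R))
    (fun t : Leb R => (f_ n (phi t))%:E).
  apply/measurable_EFinP; apply: (@measurable_fun_preimage _ _ (f_ n)).
  exact: measurable_funTS.
transitivity (\int[cmu]_(s in `[x, y]) limn (fun n => (f_ n s)%:E))%E.
  by apply: eq_integral => s /[!inE] Es; apply/esym/cvg_lim => //; exact: f_cvg.
transitivity (\int[cmu]_(t in D)
    limn (fun n => (f_ n (phi t))%:E * (w t)%:E))%E; last first.
  apply: eq_integral => t /[!inE] Dt; apply/cvg_lim => //.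
  by apply: cvgeZr => //; apply: f_cvg; exact: phiD.
rewrite (@monotone_convergence _ _ _ cmu _ mE (fun n s => (f_ n s)%:E)); first last.
- by move=> s _ m n mn; rewrite lee_fin; exact: nd_f_.
- by move=> n s _; rewrite lee_fin.
- by move=> n; apply/measurable_EFinP; exact: measurable_funTS.
rewrite (@monotone_convergence _ _ _ cmu _ mDL
  (fun n t => (f_ n (phi t))%:E * (w t)%:E)%E); first last.
- move=> t Dt m n mn; rewrite -!EFinM lee_fin ler_pM2r ?w_gt0//.
  exact: nd_f_.
- by move=> n t Dt; rewrite -EFinM lee_fin mulr_ge0// ltW// w_gt0.
- by move=> n; exact: emeasurable_funM.
congr (limn _); apply/funext => n.
pose A r : set R := f_ n @^-1` [set r].
have mA r : measurable (A r : set (Leb R)) by exact: measurable_sfunP.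
have mDA r := preimage_lebesgue_measurable (mA r).
have A0 r : r < 0 -> A r = set0 by move=> r0; rewrite /A preimage_nnfun0.
transitivity (\sum_(r \in range (f_ n)) (r%:E * cmu (A r `&` `[x, y])))%E.
  under eq_integral do rewrite fimfunE -fsumEFin//.
  rewrite (@ge0_integral_fsum _ _ _ cmu _ mE _
    (fun r s => (r * \1_(A r) s)%:E)); first last.
  - exact: fimfunP.
  - by move=> r s _; rewrite nnfun_muleindic_ge0.
  - by move=> r; apply/measurable_EFinP; exact: measurable_funM.
  apply: eq_fsbigr => r _.
  by rewrite (integralZl_indic_nnsfun cmu mE)// integral_indic.
transitivity (\sum_(r \in range (f_ n))
    \int[cmu]_(t in D) ((r * \1_(A r) (phi t))%:E * (w t)%:E))%E; last first.
  rewrite -(@ge0_integral_fsum _ _ _ cmu _ mDL _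
    (fun r t => (r * \1_(A r) (phi t))%:E * (w t)%:E)%E); first last.
  - exact: fimfunP.
  - move=> r t Dt; apply: mule_ge0; last by rewrite lee_fin ltW// w_gt0.
    exact: nnfun_muleindic_ge0.
  - move=> r; apply: emeasurable_funM; last exact: mwL.
    apply/measurable_EFinP.
    have mindic : measurable_fun (`[x, y]%classic : set (Leb R))
        (fun s : Leb R => r * \1_(A r) s).
      by apply: measurable_funM.
    exact: (measurable_fun_preimage mindic).
  apply: eq_integral => t _.
  rewrite [in RHS]fimfunE -fsumEFin// ge0_mule_fsuml// => r.
  exact: nnfun_muleindic_ge0.
apply: eq_fsbigr => r _.
rewrite -weighted_preimage_lebesgueE//.
(* a nonnegative function has empty level sets below 0 *)
have [r0|r0] := ltP r 0.
  rewrite A0// preimage_set0 setI0 integral_set0 mule0.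
  by rewrite integral0_eq// => t _; rewrite indic0 mulr0 mul0e.
have mDr := mDA r.
have mwDr : measurable_fun (D `&` phi @^-1` A r : set (Leb R))
    (fun t : Leb R => (w t)%:E).
  by apply: measurable_funS mwL => //; exact: subIsetl.
rewrite -(@ge0_integralZl _ _ _ cmu _ mDr _ mwDr); first last.
- by rewrite lee_fin.
- by move=> t; exact: wS_ge0.
rewrite integral_mkcondr; apply: eq_integral => t _.
rewrite EFinM -muleA patchE indicE -[phi t \in A r]/(t \in phi @^-1` A r).
by case: ifPn => tA; rewrite ?mul1e ?mul0e ?mule0.
Qed.

Lemma integral_change_of_variables (f : R -> \bar R) :
  cmu.-integrable (`[x, y]%classic : set (Leb R)) (f : Leb R -> \bar R) ->
  cmu.-integrable (D : set (Leb R)) (fun t => f (phi t) * (w t)%:E)%E /\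
  (\int[cmu]_(s in `[x, y]) f s = \int[cmu]_(t in D) (f (phi t) * (w t)%:E))%E.
Proof.
move=> intf; have mf := measurable_int _ intf.
have mg : measurable_fun (D : set (Leb R))
    (fun t : Leb R => (f (phi t) * (w t)%:E)%E).
  by apply: emeasurable_funM; [exact: measurable_fun_preimage mf|exact: mwL].
have w0 t : D t -> (0 <= (w t)%:E)%E by move=> Dt; rewrite lee_fin ltW// w_gt0.
have intg : cmu.-integrable (D : set (Leb R)) (fun t => f (phi t) * (w t)%:E)%E.
  apply/integrableP; split; first exact: mg.
  have /integrableP[_] := intf.
  rewrite ge0_integral_change_of_variables; last 2 first.
  - exact: measurableT_comp.
  - by move=> s _; exact: abse_ge0.
  congr (_ < _)%E; apply: eq_integral => t /[!inE] Dt.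
  by rewrite abseM (gee0_abs (w0 _ Dt)).
split; first exact: intg.
rewrite integralE [RHS]integralE; congr (_ - _)%E.
- rewrite ge0_integral_change_of_variables; last 2 first.
  + exact: measurable_funepos.
  + by move=> s _; exact: funepos_ge0.
  apply: eq_integral => t /[!inE] Dt.
  by rewrite !funeposE maxe_pMl// ?mul0e// w0.
- rewrite ge0_integral_change_of_variables; last 2 first.
  + exact: measurable_funeneg.
  + by move=> s _; exact: funeneg_ge0.
  apply: eq_integral => t /[!inE] Dt.
  by rewrite !funenegE maxe_pMl// ?mul0e// ?mulNe// w0.
Qed.

End change_of_variables.

(** * Substitution of a reflection and of a harmonic segment *)

Section substitutions.
Context {R : realType}.
Implicit Types (f h : R -> R) (x y s t : R).

Let mitv (i : interval R) : measurable ([set` i] : set (Leb R)).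
Proof. exact: borel_lebesgue_measurable. Qed.

Lemma Rintegral_change_of_variables (D : set R) x y (phi w : R -> R) f :
  measurable (D : set (Borel R)) ->
  measurable_fun (D : set (Borel R)) (phi : Borel R -> Borel R) ->
  (forall t, D t -> `[x, y]%classic (phi t)) ->
  measurable_fun (D : set (Borel R)) (w : Borel R -> R) ->
  (forall t, D t -> 0 < w t) -> x < y ->
  (forall c, x <= c <= y ->
    (\int[mu]_(t in D `&` phi @^-1` `[c, +oo[) (w t)%:E = (y - c)%:E)%E) ->
  lebesgue_integrable `[x, y] f ->
  lebesgue_integrable D (fun t => f (phi t) * w t) /\
  (\int[cmu]_(s in `[x, y]) f s = \int[cmu]_(t in D) (f (phi t) * w t))%R.
Proof.
move=> mD mphi phiD mw w0 xy ray intf.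
have [i1 i2] := integral_change_of_variables mD mphi phiD mw w0 xy ray intf.
by split=> //; rewrite /Rintegral i2.
Qed.

(** Swapping the end points of a harmonic segment amounts to this
    substitution. *)
Lemma integral_reflection01 f : lebesgue_integrable `[0, 1] f ->
  lebesgue_integrable `[0, 1] (fun t => f (1 - t)) /\
  lebesgue_int (fun t => f (1 - t)) 0 1 = lebesgue_int f 0 1.
Proof.
move=> intf; rewrite /lebesgue_int ler01.
have mphi : measurable_fun (`[0, 1]%classic : set (Borel R))
    (fun t : Borel R => 1 - t : Borel R) by apply: measurable_funB.
have phi01 (t : R) : `[0, 1]%classic t -> `[0, 1]%classic (1 - t).
  by rewrite /= !in_itv/= => t01; lra.
have ray (c : R) : 0 <= c <= 1 -> (\int[mu]_(t in `[0%R, 1%R] `&`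
    (fun t : R => 1 - t)%R @^-1` `[c, +oo[) (cst 1 t)%:E = (1 - c)%:E)%E.
  move=> /andP[c0 c1].
  have -> : `[0, 1] `&` (fun t : R => 1 - t) @^-1` `[c, +oo[ = `[0, 1 - c]%classic.
    by apply/seteqP; split => t /=; rewrite !in_itv/= !andbT; lra.
  transitivity (1 * (mu `[0%R, (1 - c)%R]))%E; first exact: (integral_cst mu _ 1%E).
  rewrite mul1e lebesgue_measure_itv/= lte_fin.
  case: ifPn => [_|]; first by rewrite -EFinB subr0.
  rewrite -leNgt => c1'; have -> : c = 1 by lra.
  by rewrite subrr.
have m01 : measurable (`[0, 1]%classic : set (Borel R)) by [].
have mw : measurable_fun (`[0, 1]%classic : set (Borel R))
  (cst 1 : Borel R -> R) by [].
have [] := Rintegral_change_of_variables m01 mphi phi01 mw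
  (fun _ _ => ltr01) ltr01 ray intf.
have -> : (fun t => f (1 - t) * cst 1 t) = (fun t => f (1 - t)).
  by apply/funext => t; rewrite mulr1.
by move=> ? ->.
Qed.

(** At [t = 0] this is [x], at [t = 1] it is [y]; the argument order is that of
    the definition of harmonic h-convexity. *)
Definition harmonic_segment x y t : R := x * y / (t * x + (1 - t) * y).

Section harmonic_segment.
Variables x y : R.
Hypotheses (xy : x < y) (xy0 : 0 < x * y).
Let den t : R := t * x + (1 - t) * y.
(** The derivative of the harmonic segment. Its being proportional to the square
    of the segment is what absorbs the weight [1 / s ^+ 2]. *)
Let w t : R := (y - x) / (x * y) * harmonic_segment x y t ^+ 2.

Let mid_same_sign s t : x <= s <= y -> x <= t <= y -> 0 < s / t.
Proof.
move=> /andP[xs sy] /andP[xt ty].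
have [x0|x0] := ltP 0 x.
  by rewrite divr_gt0//; apply: lt_le_trans x0 _.
have y0 : y < 0.
  by rewrite ltNge; apply/negP => /(mulr_le0_ge0 x0); rewrite leNgt xy0.
by rewrite -mulrNN -invrN divr_gt0// oppr_gt0; apply: le_lt_trans y0.
Qed.

Let den_itv t : 0 <= t <= 1 -> x <= den t <= y.
Proof.
move=> /andP[t0 t1]; rewrite /den; apply/andP; split; rewrite -subr_ge0.
  have -> : t * x + (1 - t) * y - x = (1 - t) * (y - x) by ring.
  by rewrite mulr_ge0// subr_ge0// ltW.
have -> : y - (t * x + (1 - t) * y) = t * (y - x) by ring.
by rewrite mulr_ge0// subr_ge0// ltW.
Qed.

Let itv_neq0 s : x <= s <= y -> s != 0.
Proof.
move=> sxy; have := mid_same_sign sxy sxy.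
by apply: contraTneq => ->; rewrite mul0r ltxx.
Qed.

Let x_neq0 : x != 0. Proof. by apply: itv_neq0; rewrite lexx ltW. Qed.
Let y_neq0 : y != 0. Proof. by apply: itv_neq0; rewrite lexx ltW. Qed.

(** The parameter at which the harmonic segment takes the value [c]. *)
Let ray_start c : R := y * (c - x) / (c * (y - x)).

Let harmonic_segment_sub c t : x <= c <= y -> 0 <= t <= 1 ->
  harmonic_segment x y t - c = (t - ray_start c) * (c / den t * (y - x)).
Proof.
move=> cxy t01; rewrite /harmonic_segment /ray_start -/(den t).
have c0 := itv_neq0 cxy; have d0 := itv_neq0 (den_itv t01).
have yx0 : y - x != 0 by rewrite subr_eq0 gt_eqF.
have -> : t - y * (c - x) / (c * (y - x)) =
  (x * y - c * den t) / (c * (y - x)) by rewrite /den; field; rewrite c0 yx0.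
by field; rewrite c0 d0 yx0.
Qed.

Let harmonic_segment_ge c t : x <= c <= y -> 0 <= t <= 1 ->
  (c <= harmonic_segment x y t) = (ray_start c <= t).
Proof.
move=> cxy t01; rewrite -subr_ge0 harmonic_segment_sub// pmulr_lge0 ?subr_ge0//.
by rewrite mulr_gt0 ?subr_gt0// mid_same_sign// den_itv.
Qed.

Let ray_start01 c : x <= c <= y -> 0 <= ray_start c <= 1.
Proof.
move=> cxy; have /andP[xc cy] := cxy.
have c0 := itv_neq0 cxy.
have yx0 : y - x != 0 by rewrite subr_eq0 gt_eqF.
have yxE : x <= y <= y by rewrite lexx ltW.
have xxE : x <= x <= y by rewrite lexx ltW.
have yc := mid_same_sign yxE cxy; have xc' := mid_same_sign xxE cxy.
apply/andP; split.
  have -> : ray_start c = (y / c) * ((c - x) / (y - x)).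
    by rewrite /ray_start; field; rewrite c0 yx0.
  by apply: mulr_ge0; [exact: ltW|apply: divr_ge0; rewrite subr_ge0// ltW].
rewrite -subr_ge0.
have -> : 1 - ray_start c = (x / c) * ((y - c) / (y - x)).
  by rewrite /ray_start; field; rewrite c0 yx0.
by apply: mulr_ge0; [exact: ltW|apply: divr_ge0; rewrite subr_ge0// ltW].
Qed.

Lemma harmonic_segment_itv t : 0 <= t <= 1 ->
  `[x, y]%classic (harmonic_segment x y t).
Proof.
have yxE : x <= y <= y by rewrite lexx ltW.
have xxE : x <= x <= y by rewrite lexx ltW.
move=> t01; rewrite /= in_itv/=; apply/andP; split.
  rewrite harmonic_segment_ge// /ray_start subrr mulr0 mul0r.
  by have /andP[] := t01.
rewrite -subr_le0 harmonic_segment_sub// pmulr_lle0.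
  rewrite /ray_start divff; first by rewrite subr_le0; have /andP[] := t01.
  by rewrite mulf_neq0// subr_eq0 gt_eqF.
by rewrite mulr_gt0 ?subr_gt0// mid_same_sign// den_itv.
Qed.

Let is_derive_harmonic_segment t : 0 <= t <= 1 ->
  is_derive t 1 (harmonic_segment x y) (w t).
Proof.
move=> t01; have d0 := itv_neq0 (den_itv t01).
have dd : is_derive t 1 den (x - y).
  have -> : den = cst y + (x - y) \*: id.
    apply/funext => s.
    by change (s * x + (1 - s) * y = y + (x - y) * s); ring.
  have := is_deriveD (is_derive_cst y t 1)
    (is_deriveZ (x - y) (is_derive_id t (1 : R))).
  by rewrite add0r /GRing.scale/= mulr1.
have [dden Dden] := dd.
have dV : derivable (fun s => (den s)^-1) t 1 by exact: derivableV.
have -> : harmonic_segment x y = (x * y) \*: (fun s => (den s)^-1).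
  by apply/funext.
apply: DeriveDef; first exact: derivableZ.
rewrite deriveZ; last exact: dV.
rewrite (deriveV d0 dden) Dden /w /harmonic_segment -/(den t) /GRing.scale/=.
by field; rewrite d0 x_neq0 y_neq0.
Qed.

Let continuous_harmonic_segment (p q : R) : 0 <= p -> q <= 1 ->
  {within `[p, q], continuous (harmonic_segment x y)}.
Proof.
move=> p0 q1; apply: derivable_within_continuous => t.
rewrite in_itv/= => /andP[pt tq].
have t01 : 0 <= t <= 1 by rewrite (le_trans p0 pt) (le_trans tq q1).
by have [] := is_derive_harmonic_segment t01.
Qed.

Let continuous_w (p q : R) : 0 <= p -> q <= 1 -> {within `[p, q], continuous w}.
Proof.
move=> p0 q1 t.
have c := @continuous_harmonic_segment p q p0 q1 t.
apply: cvgM; first exact: cvg_cst.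
exact: cvgM.
Qed.

Let w_gt0 t : 0 <= t <= 1 -> 0 < w t.
Proof.
move=> t01; rewrite /w mulr_gt0 ?divr_gt0 ?subr_gt0// exprn_even_gt0//=.
apply: itv_neq0; exact: harmonic_segment_itv.
Qed.

(** The fundamental theorem of calculus on [[ray_start c, 1]]. *)
Let harmonic_segment_ray_mass c : x <= c <= y ->
  (\int[mu]_(t in `[0%R, 1%R] `&` harmonic_segment x y @^-1` `[c, +oo[) (w t)%:E
   = (y - c)%:E)%E.
Proof.
move=> cxy; have /andP[s0 s1] := ray_start01 cxy.
have yxE : x <= y <= y by rewrite lexx ltW.
have -> : `[0, 1] `&` harmonic_segment x y @^-1` `[c, +oo[ =
    `[ray_start c, 1]%classic.
  apply/seteqP; split => t /=; rewrite !in_itv/= !andbT.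
    by move=> [t01]; rewrite harmonic_segment_ge// => ->; case/andP: t01.
  move=> /andP[st t1]; have t01 : 0 <= t <= 1 by rewrite t1 (le_trans s0 st).
  by rewrite harmonic_segment_ge.
have phi1 : harmonic_segment x y 1 = y.
  by rewrite /harmonic_segment mul1r subrr mul0r addr0 mulrAC mulfV ?mul1r.
have phis : harmonic_segment x y (ray_start c) = c.
  apply/eqP; rewrite -subr_eq0 harmonic_segment_sub ?s0//.
  by rewrite subrr mul0r.
(* the interval degenerates to a point when [c = y] *)
move: s1; rewrite le_eqVlt => /predU1P[sE|s1].
  rewrite sE set_itv1 integral_set1.
  by rewrite -phis sE phi1 subrr.
rewrite (@continuous_FTC2 _ _ (harmonic_segment x y))//.
- by rewrite phi1 phis -EFinB.
- exact: continuous_w.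
- have cphi := continuous_harmonic_segment s0 (lexx 1).
  have [cin cr cl] := (continuous_within_itvP _ s1).1 cphi.
  split; [move=> t; rewrite in_itv/= => /andP[st t1]|exact: cr|exact: cl].
  have t01 : 0 <= t <= 1 by rewrite (ltW t1) (le_trans s0 (ltW st)).
  by have [] := is_derive_harmonic_segment t01.
- move=> t; rewrite in_itv/= => /andP[st t1].
  have t01 : 0 <= t <= 1 by rewrite (ltW t1) (le_trans s0 (ltW st)).
  have [_ <-] := is_derive_harmonic_segment t01.
  by rewrite derive1E.
Qed.

Lemma integral_harmonic_segment_lt f : lebesgue_integrable `[x, y] f ->
  lebesgue_integrable `[0, 1] (f \o harmonic_segment x y) /\
  x * y / (y - x) * lebesgue_int (fun s => f s / s ^+ 2) x y =
  lebesgue_int (f \o harmonic_segment x y) 0 1.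
Proof.
move=> intf.
have mE : measurable (`[x, y]%classic : set (Leb R)) by exact: mitv.
have m01L : measurable (`[0, 1]%classic : set (Leb R)) by exact: mitv.
(* [1 / s ^+ 2] is bounded, so that [f s / s ^+ 2] inherits integrability *)
have sq_gt0 s : x <= s <= y -> 0 < s ^+ 2.
  by move=> /itv_neq0; rewrite exprn_even_gt0.
have xxE : x <= x <= y by rewrite lexx ltW.
have yxE : x <= y <= y by rewrite lexx ltW.
have inv_bounded s : x <= s <= y -> s ^- 2 <= x ^- 2 + y ^- 2.
  move=> sE; have /andP[xs sy] := sE; have [x0|x0] := ltP 0 x.
    rewrite -[leLHS]addr0 lerD ?invr_ge0 ?sqr_ge0// lef_pV2 ?posrE ?sq_gt0//.
    by rewrite lerXn2r// nnegrE ltW// (lt_le_trans x0).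
  have y0 : y < 0.
    by rewrite ltNge; apply/negP => /(mulr_le0_ge0 x0); rewrite leNgt xy0.
  rewrite -[leLHS]add0r lerD ?invr_ge0 ?sqr_ge0// lef_pV2 ?posrE ?sq_gt0//.
  rewrite -sqrrN -[leRHS]sqrrN lerXn2r ?nnegrE ?lerN2 ?oppr_ge0 ?(ltW y0)//.
  by rewrite (le_trans sy (ltW y0)).
have minv : measurable_fun (`[x, y]%classic : set (Leb R))
    (fun s : Leb R => s ^- 2 : R).
  apply: borel_lebesgue_measurable_fun => //.
  apply: subspace_continuous_measurable_fun => //.
  apply: continuous_in_subspaceT => s; rewrite inE/= in_itv/= => sE.
  by apply: (@cvgV _ _ (nbhs s)); [rewrite gt_eqF// sq_gt0|exact: exprn_continuous].
have binv : [bounded (s ^- 2 : R^o) | s in `[x, y]%classic].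
  exists (x ^- 2 + y ^- 2); split; first exact: num_real.
  move=> M /ltW BM s /=; rewrite in_itv/= => sE.
  rewrite ger0_norm; last by rewrite invr_ge0 ltW// sq_gt0.
  exact: le_trans (inv_bounded _ sE) BM.
have intg : lebesgue_integrable `[x, y] (fun s => f s / s ^+ 2).
  exact: (@integrableMl _ (Leb R) R cmu _ mE (EFin \o f) _ intf minv binv).
have m01 : measurable (`[0, 1]%classic : set (Borel R)) by [].
have mphi : measurable_fun (`[0, 1]%classic : set (Borel R))
    (harmonic_segment x y : Borel R -> Borel R).
  apply: subspace_continuous_measurable_fun => //.
  exact: continuous_harmonic_segment.
have mw : measurable_fun (`[0, 1]%classic : set (Borel R)) (w : Borel R -> R).
  apply: subspace_continuous_measurable_fun => //.
  exact: continuous_w.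
have [intG EG] := Rintegral_change_of_variables m01 mphi harmonic_segment_itv mw
  w_gt0 xy harmonic_segment_ray_mass intg.
have GE : {in `[0, 1]%classic, (fun t => f (harmonic_segment x y t) /
    harmonic_segment x y t ^+ 2 * w t) =1
    (fun t => (y - x) / (x * y) * f (harmonic_segment x y t))}.
  move=> t /[!inE]/harmonic_segment_itv/itv_neq0 p0.
  by rewrite /w; field; rewrite p0 x_neq0 y_neq0.
have intfphi : lebesgue_integrable `[0, 1] (f \o harmonic_segment x y).
  have := @integrableZl _ (Leb R) R cmu _ m01L (x * y / (y - x)) _ intG.
  apply: (eq_integrable m01L) => t tE /=.
  rewrite (GE _ tE) -EFinM; congr EFin.
  by field; rewrite x_neq0 y_neq0 subr_eq0 gt_eqF.
split; first exact: intfphi.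
rewrite /lebesgue_int ltW// ler01 EG.
transitivity (x * y / (y - x) * (\int[cmu]_(t in `[0%R, 1%R])
    ((y - x) / (x * y) * (f \o harmonic_segment x y) t))).
  by congr (_ * _); exact: eq_Rintegral.
rewrite (RintegralZl _ m01L intfphi).
by field; rewrite x_neq0 y_neq0 subr_eq0 gt_eqF.
Qed.

End harmonic_segment.
End substitutions.

Section lebesgue_int_lemmas.
Context {R : realType}.
Implicit Types (f g h : R -> R) (a b x y s t : R).

Let mitv (i : interval R) : measurable ([set` i] : set (Leb R)).
Proof. exact: borel_lebesgue_measurable. Qed.

Lemma lebesgue_intC f x y : x != y -> lebesgue_int f y x = - lebesgue_int f x y.
Proof.
by rewrite /lebesgue_int; case: ltgtP => // _ _; rewrite opprK.
Qed.

Lemma lebesgue_integrableW f a b x y : a <= x -> y <= b ->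
  lebesgue_integrable `[a, b] f -> lebesgue_integrable `[x, y] f.
Proof.
move=> ax yb intf.
apply: (integrableS (mitv `[a, b]) (mitv `[x, y]) _ intf) => t /=.
by rewrite !in_itv/= => /andP[xt ty]; rewrite (le_trans ax) ?(le_trans ty).
Qed.

Lemma harmonic_segmentC x y t :
  harmonic_segment y x t = harmonic_segment x y (1 - t).
Proof. by rewrite /harmonic_segment; congr (_ / _); ring. Qed.

(** For [y < x] the segment is run through backwards: the integral changes sign
    and so does [y - x]. *)
Lemma integral_harmonic_segment f a b x y : 0 < x * y -> x != y ->
  a <= x <= b -> a <= y <= b -> lebesgue_integrable `[a, b] f ->
  lebesgue_integrable `[0, 1] (f \o harmonic_segment x y) /\
  x * y / (y - x) * lebesgue_int (fun s => f s / s ^+ 2) x y =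
  lebesgue_int (f \o harmonic_segment x y) 0 1.
Proof.
move=> xy0 xy /andP[ax xb] /andP[ay yb] intf.
case: (ltgtP x y) xy => // [xy|yx] _.
  exact/(integral_harmonic_segment_lt xy xy0)/(lebesgue_integrableW ax yb).
rewrite mulrC in xy0.
have [i1 i2] :=
  integral_harmonic_segment_lt yx xy0 (lebesgue_integrableW ay xb intf).
have [r1 r2] := integral_reflection01 i1.
have fE : (fun t => (f \o harmonic_segment y x) (1 - t)) =
    f \o harmonic_segment x y.
  by apply/funext => t /=; rewrite harmonic_segmentC subKr.
rewrite fE in r1 r2; split => //.
rewrite r2 -i2 (@lebesgue_intC _ y x) ?lt_eqF// mulrN -mulNr.
congr (_ * _); field; rewrite !subr_eq0 gt_eqF//=.
by rewrite lt_eqF.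
Qed.

(** The inequality is only asked for inside the interval because h-convexity
    says nothing about [h 0] and [h 1]. *)
Lemma le_lebesgue_int01 f g : lebesgue_integrable `[0, 1] f ->
  lebesgue_integrable `[0, 1] g -> (forall t, 0 < t < 1 -> f t <= g t) ->
  lebesgue_int f 0 1 <= lebesgue_int g 0 1.
Proof.
move=> intf intg fg; rewrite /lebesgue_int ler01.
have m01 := mitv `[0%R, 1%R].
have oo h : lebesgue_integrable `[0, 1] h ->
    \int[cmu]_(t in `[0, 1]) h t = \int[cmu]_(t in `]0, 1[) h t.
  move=> inth; pose N : set R := [set 0] `|` [set 1].
  have mN : measurable (N : set (Borel R)) by exact: measurableU.
  have N0 : mu N = 0%E.
    apply/eqP; rewrite eq_le measure_ge0 andbT.
    apply: (@le_trans _ _ (mu [set 0%R : R] + mu [set 1%R : R])%E).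
      exact: measureU2.
    by rewrite !lebesgue_measure_set1 adde0.
  rewrite /Rintegral.
  rewrite (negligible_integral (borel_lebesgue_measurable mN) m01 inth N0).
  congr (fine (integral _ _ _)); apply/seteqP; split => t /=; rewrite !in_itv/=.
    move=> [/andP[t0 t1] nNt]; rewrite !lt_neqAle t0 t1 !andbT.
    by apply/andP; split; apply/eqP => tE; apply: nNt; [left|right].
  move=> /andP[t0 t1]; split; first by rewrite !ltW.
  by case=> tE; move: t0 t1; rewrite tE ltxx.
rewrite !oo//; have sub : `]0%R : R, 1%R[%classic `<=` `[0%R : R, 1%R]%classic.
  exact: subset_itv_oo_cc.
apply: (le_Rintegral (mitv `]0%R, 1%R[)).
- exact: (integrableS m01 (mitv _) sub intf).
- exact: (integrableS m01 (mitv _) sub intg).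
- by move=> t /=; rewrite in_itv/=; exact: fg.
Qed.

(** The Hermite-Hadamard argument: integrate both hypotheses, with [g] and [h]
    having the same integral as their reflections [t |-> 1 - t]. *)
Lemma hermite_hadamard01 h g (k0 k1 m : R) :
  lebesgue_integrable `[0, 1] h -> lebesgue_integrable `[0, 1] g ->
  (forall t, 0 < t < 1 -> g t <= h t * k1 + h (1 - t) * k0) ->
  (forall t, 0 < t < 1 -> m <= h (1 / 2) * (g t + g (1 - t))) ->
  m <= 2 * h (1 / 2) * lebesgue_int g 0 1 /\
  lebesgue_int g 0 1 <= (k0 + k1) * lebesgue_int h 0 1.
Proof.
move=> inth intg gh mg.
have m01 := mitv `[0%R, 1%R].
have [inth' hE] := integral_reflection01 inth.
have [intg' gE] := integral_reflection01 intg.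
have intZ k f : lebesgue_integrable `[0, 1] f ->
    lebesgue_integrable `[0, 1] (fun t => k * f t) /\
    lebesgue_int (fun t => k * f t) 0 1 = k * lebesgue_int f 0 1.
  move=> intf; split; last by rewrite /lebesgue_int ler01 RintegralZl.
  exact: (@integrableZl _ (Leb R) R cmu _ m01 k (EFin \o f) intf).
have intD f1 f2 : lebesgue_integrable `[0, 1] f1 ->
    lebesgue_integrable `[0, 1] f2 ->
    lebesgue_integrable `[0, 1] (fun t => f1 t + f2 t) /\
    lebesgue_int (fun t => f1 t + f2 t) 0 1 =
    lebesgue_int f1 0 1 + lebesgue_int f2 0 1.
  move=> i1 i2; split; last by rewrite /lebesgue_int ler01 RintegralD.
  exact: (@integrableD _ (Leb R) R cmu _ m01 (EFin \o f1) (EFin \o f2) i1 i2).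
have [gg1 gg2] := intD _ _ intg intg'.
have [hgg1 hgg2] := intZ (h (1 / 2)) _ gg1.
have [hk1 hk2] := intZ k1 _ inth.
have [hk1' hk2'] := intZ k0 _ inth'.
have [hh1 hh2] := intD _ _ hk1 hk1'.
split.
- have icst : lebesgue_integrable `[0, 1] (cst m) /\ lebesgue_int (cst m) 0 1 = m.
    have mE : mu `[0%R, 1%R]%classic = 1%E :> \bar R.
      by rewrite lebesgue_measure_itv/= lte_fin ltr01 oppr0 adde0.
    have cE : cmu `[0%R, 1%R]%classic = 1%E :> \bar R by exact: mE.
    split; last first.
      rewrite /lebesgue_int ler01.
      transitivity (m * fine (cmu `[0%R : R, 1%R]%classic)).
        exact: Rintegral_cst.
      by rewrite cE mulr1.
    apply: (measurable_bounded_integrable m01).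
    - by have := ltry (1 : R); rewrite -cE.
    - exact: measurable_cst.
    - exists `|m|; split; first exact: num_real.
      by move=> M /ltW mM t _.
  have [ic <-] := icst.
  have := le_lebesgue_int01 ic hgg1 mg.
  rewrite hgg2 gg2 gE => /le_trans; apply.
  by rewrite le_eqVlt; apply/orP; left; apply/eqP; ring.
- have := le_lebesgue_int01 intg hh1.
  rewrite hh2 hk2 hk2' hE -mulrDl [k1 + k0]addrC; apply => t t01.
  by rewrite [k1 * _]mulrC [k0 * _]mulrC; exact: gh.
Qed.

End lebesgue_int_lemmas.

(** The convex case for [- g], with [h] unchanged. *)
Lemma hermite_hadamard01_concave (R : realType) (h g : R -> R) (k0 k1 m : R) :
  lebesgue_integrable `[0, 1] h -> lebesgue_integrable `[0, 1] g ->
  (forall t, 0 < t < 1 -> h t * k1 + h (1 - t) * k0 <= g t) ->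
  (forall t, 0 < t < 1 -> h (1 / 2) * (g t + g (1 - t)) <= m) ->
  2 * h (1 / 2) * lebesgue_int g 0 1 <= m /\
  (k0 + k1) * lebesgue_int h 0 1 <= lebesgue_int g 0 1.
Proof.
move=> inth intg hg gm.
have m01 : measurable (`[0, 1]%classic : set (Leb R)).
  exact: borel_lebesgue_measurable.
have intNg : lebesgue_integrable `[0, 1] (fun t => - g t).
  have := @integrableZl _ (Leb R) R cmu _ m01 (-1) _ intg.
  apply: (eq_integrable m01) => t _ /=.
  by rewrite -EFinM mulN1r.
have NgE : lebesgue_int (fun t => - g t) 0 1 = - lebesgue_int g 0 1.
  rewrite /lebesgue_int ler01 -[RHS]mulN1r -(RintegralZl _ m01 intg).
  by apply: eq_Rintegral => t _; rewrite mulN1r.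
have [||lb ub] := @hermite_hadamard01 R h _ (- k0) (- k1) (- m) inth intNg.
- by move=> t t01; rewrite !mulrN -opprD lerN2; exact: hg.
- by move=> t t01; rewrite -opprD mulrN lerN2; exact: gm.
by move: lb ub; rewrite NgE mulrN lerN2 -opprD mulNr lerN2.
Qed.

(** * The harmonic reflection of an interval *)

Section harmonic_reflection.
Context {R : realType}.
Variables a b : R.
Hypotheses (ab : a < b) (ab_neq0 : `[a, b] `<=` [set t : R | t != 0]).
Implicit Types x y t : R.

(** An interval that avoids 0 lies on one side of it. *)
Lemma itv_mul_gt0 x y : a <= x <= b -> a <= y <= b -> 0 < x * y.
Proof.
move=> /andP[ax xb] /andP[ay yb]; have [a0|a0] := ltP 0 a.
  by rewrite mulr_gt0//; apply: lt_le_trans a0 _.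
have b0 : b < 0.
  rewrite ltNge; apply/negP => b0.
  have /= := @ab_neq0 0; rewrite in_itv/= a0 b0 eqxx => /(_ isT) //.
by rewrite -mulrNN mulr_gt0// oppr_gt0; apply: le_lt_trans b0.
Qed.

Let aE : a <= a <= b. Proof. by rewrite lexx ltW. Qed.
Let bE : a <= b <= b. Proof. by rewrite lexx ltW. Qed.

Let itv_neq0 x : a <= x <= b -> x != 0.
Proof. by move=> xE; apply: (@ab_neq0 x); rewrite /= in_itv. Qed.

(** The denominator is [a * t + b * (t - a)] and also [b * t + a * (t - b)];
    the first form is visibly positive on the positive side of 0, the second one
    on the negative side. *)
Lemma harm_refl_den_gt0 t : a <= t <= b -> 0 < (a + b) * t - a * b.
Proof.
move=> tE; have /andP[at0 tb] := tE.
have [a0|a0] := ltP 0 a.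
  have -> : (a + b) * t - a * b = a * t + b * (t - a) by ring.
  by rewrite ltr_pwDl ?itv_mul_gt0// mulr_ge0 ?subr_ge0// (le_trans (ltW a0)) ?ltW.
have -> : (a + b) * t - a * b = b * t + a * (t - b) by ring.
by rewrite ltr_pwDl ?itv_mul_gt0// mulr_le0// subr_le0.
Qed.

Lemma harm_refl_itv t : a <= t <= b -> a <= harm_refl a b t <= b.
Proof.
move=> tE; have d0 := harm_refl_den_gt0 tE; have /andP[at0 tb] := tE.
rewrite /harm_refl ler_pdivlMr// ler_pdivrMr//; apply/andP; split.
  rewrite -subr_ge0.
  have -> : a * b * t - a * ((a + b) * t - a * b) = a ^+ 2 * (b - t) by ring.
  by rewrite mulr_ge0 ?sqr_ge0 ?subr_ge0.
rewrite -subr_ge0.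
have -> : b * ((a + b) * t - a * b) - a * b * t = b ^+ 2 * (t - a) by ring.
by rewrite mulr_ge0 ?sqr_ge0 ?subr_ge0.
Qed.

Lemma harm_refl_left : harm_refl a b a = b.
Proof.
rewrite /harm_refl (_ : (a + b) * a - a * b = a * a); last by ring.
by field; rewrite itv_neq0.
Qed.

Lemma harm_refl_right : harm_refl a b b = a.
Proof.
rewrite /harm_refl (_ : (a + b) * b - a * b = b * b); last by ring.
by field; rewrite itv_neq0.
Qed.

(** The factor in front of [y - x] is the one by which the reflection changes the
    product [x * y]: in the coordinate 1/t, where the reflection reverses
    differences, [(y - x) / (x * y)] is the difference of 1/x and 1/y. *)
Lemma harm_refl_sub x y : a <= x <= b -> a <= y <= b ->
  harm_refl a b x - harm_refl a b y =
  (a * b) ^+ 2 / (((a + b) * x - a * b) * ((a + b) * y - a * b)) * (y - x).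
Proof.
move=> xE yE; have dx := lt0r_neq0 (harm_refl_den_gt0 xE).
have dy := lt0r_neq0 (harm_refl_den_gt0 yE).
by rewrite /harm_refl; field; rewrite dx dy.
Qed.

Lemma harm_refl_neq x y : a <= x <= b -> a <= y <= b -> x != y ->
  harm_refl a b x != harm_refl a b y.
Proof.
move=> xE yE xy; rewrite -subr_eq0 harm_refl_sub//.
have dx := lt0r_neq0 (harm_refl_den_gt0 xE).
have dy := lt0r_neq0 (harm_refl_den_gt0 yE).
apply: mulf_neq0; last by rewrite subr_eq0 eq_sym.
apply: mulf_neq0; first by rewrite expf_neq0// mulf_neq0// itv_neq0.
by rewrite invr_neq0// mulf_neq0.
Qed.

Let den_neq0 x y t : a <= x <= b -> a <= y <= b -> 0 <= t <= 1 ->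
  t * x + (1 - t) * y != 0.
Proof.
move=> /andP[ax xb] /andP[ay yb] /andP[t0 t1]; apply: itv_neq0.
have t1' : 0 <= 1 - t by rewrite subr_ge0.
by have := ler_wpM2l t0 ax; have := ler_wpM2l t0 xb;
  have := ler_wpM2l t1' ay; have := ler_wpM2l t1' yb; lra.
Qed.

Lemma harmonic_segment_in_itv x y t : a <= x <= b -> a <= y <= b ->
  0 <= t <= 1 -> a <= harmonic_segment x y t <= b.
Proof.
move=> xE yE t01; have xy0 := itv_mul_gt0 xE yE.
have /andP[ax xb] := xE; have /andP[ay yb] := yE.
have [xy|yx|xyE] := ltgtP x y.
- have /= := harmonic_segment_itv xy xy0 t01; rewrite in_itv/= => /andP[xs sy].
  by rewrite (le_trans ax xs) (le_trans sy yb).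
- rewrite mulrC in xy0; rewrite -[t](subKr 1) -harmonic_segmentC.
  have t01' : 0 <= 1 - t <= 1 by case/andP: t01 => t0 t1; lra.
  have /= := harmonic_segment_itv yx xy0 t01'; rewrite in_itv/= => /andP[ys sx].
  by rewrite (le_trans ay ys) (le_trans sx xb).
- rewrite /harmonic_segment -xyE -mulrDl addrC subrK mul1r mulfK ?itv_neq0//.
Qed.

(** In the coordinate 1/t the reflection is affine and a harmonic segment is an
    affine segment. *)
Lemma harm_refl_segment x y t : a <= x <= b -> a <= y <= b -> 0 <= t <= 1 ->
  harm_refl a b (harmonic_segment x y t) =
  harmonic_segment (harm_refl a b x) (harm_refl a b y) t.
Proof.
move=> xE yE t01.
have dx := lt0r_neq0 (harm_refl_den_gt0 xE).
have dy := lt0r_neq0 (harm_refl_den_gt0 yE).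
have ds := lt0r_neq0 (harm_refl_den_gt0 (harmonic_segment_in_itv xE yE t01)).
have d0 := den_neq0 xE yE t01.
have a0 := itv_neq0 aE; have b0 := itv_neq0 bE.
(* the common numerator of the two denominators *)
pose d := (a + b) * (x * y) - a * b * (t * x + (1 - t) * y).
have dsE : (a + b) * harmonic_segment x y t - a * b =
    d / (t * x + (1 - t) * y).
  by rewrite /harmonic_segment /d; field.
have drE : t * harm_refl a b x + (1 - t) * harm_refl a b y =
    a * b * d / (((a + b) * x - a * b) * ((a + b) * y - a * b)).
  by rewrite /harm_refl /d; field; rewrite dx dy.
have dn0 : d != 0 by move: ds; rewrite dsE mulf_eq0 negb_or => /andP[].
rewrite [RHS]/harmonic_segment drE [LHS]/harm_refl dsE /harmonic_segment.
rewrite /harm_refl; field.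
by rewrite d0 dn0 dx dy a0 b0.
Qed.

(** The reflected integral runs from the image of [y] to that of [x], so that its
    harmonic segment is the image of the segment from [x] to [y], traversed
    backwards. *)
Lemma symm_mean_identity f x y : a <= x <= b -> a <= y <= b -> x != y ->
  lebesgue_integrable `[a, b] f ->
  lebesgue_integrable `[0, 1] (symm_transform a b f \o harmonic_segment x y) /\
  x * y / (2 * (y - x)) *
    (lebesgue_int (fun t => f t / t ^+ 2) x y +
     lebesgue_int (fun t => f t / t ^+ 2)
       (harm_refl a b y) (harm_refl a b x)) =
  lebesgue_int (symm_transform a b f \o harmonic_segment x y) 0 1.
Proof.
move=> xE yE xy intf.
have sxE := harm_refl_itv xE; have syE := harm_refl_itv yE.
have sxy : harm_refl a b y != harm_refl a b x by rewrite eq_sym harm_refl_neq.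
have [i1 i2] := integral_harmonic_segment (itv_mul_gt0 xE yE) xy xE yE intf.
have [j1 j2] :=
  integral_harmonic_segment (itv_mul_gt0 syE sxE) sxy syE sxE intf.
have [k1 k2] := integral_reflection01 j1.
have dx := lt0r_neq0 (harm_refl_den_gt0 xE).
have dy := lt0r_neq0 (harm_refl_den_gt0 yE).
have a0 := itv_neq0 aE; have b0 := itv_neq0 bE.
have yx0 : y - x != 0 by rewrite subr_eq0 eq_sym.
have coefE : harm_refl a b y * harm_refl a b x /
    (harm_refl a b x - harm_refl a b y) = x * y / (y - x).
  rewrite harm_refl_sub// /harm_refl; field.
  by rewrite dx dy a0 b0 yx0.
rewrite coefE in j2.
have m01 : measurable (`[0, 1]%classic : set (Leb R)).
  exact: borel_lebesgue_measurable.
set g := fun t => (f \o harmonic_segment (harm_refl a b y) (harm_refl a b x))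
  (1 - t) in k1 k2.
have gE : {in `[0, 1]%classic,
    (fun t => 2^-1 * ((f \o harmonic_segment x y) t + g t)) =1
    symm_transform a b f \o harmonic_segment x y}.
  move=> t /[!inE]/=; rewrite in_itv/= => t01.
  by rewrite /symm_transform harm_refl_segment// /g /=
    (harmonic_segmentC (harm_refl a b x)) subKr.
have intD := @integrableD _ (Leb R) R cmu _ m01 (EFin \o _) (EFin \o g) i1 k1.
have intZ := @integrableZl _ (Leb R) R cmu _ m01 2^-1 _ intD.
split.
  move: intZ; apply: (eq_integrable m01) => t tE.
  exact: (congr1 EFin (gE _ tE)).
transitivity (2^-1 * (lebesgue_int (f \o harmonic_segment x y) 0 1 +
    lebesgue_int g 0 1)).
  by rewrite k2 -i2 -j2; field.
rewrite /lebesgue_int ler01.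
rewrite -(RintegralD m01 i1 k1) -(RintegralZl _ m01 intD).
exact: eq_Rintegral.
Qed.

End harmonic_reflection.

(** * The symmetrized Hermite-Hadamard inequalities *)

Section symmetrized_hermite_hadamard.
Context {R : realType}.
Variables (a b : R) (h f : R -> R).
Hypotheses (ab : a < b) (ab_neq0 : `[a, b] `<=` [set t : R | t != 0]).
Hypotheses (h_int : lebesgue_integrable `[0, 1] h).
Hypotheses (f_int : lebesgue_integrable `[a, b] f).
Implicit Types x y t : R.

Let F := symm_transform a b f.

Let itv_neq0 x : a <= x <= b -> x != 0.
Proof. by move=> xE; apply: (@ab_neq0 x); rewrite /= in_itv. Qed.

Let itv01 t : 0 < t < 1 -> 0 <= t <= 1 /\ 0 <= 1 - t <= 1.
Proof. by move=> /andP[t0 t1]; split; lra. Qed.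

Let half01 : 0 < (1 / 2 : R) < 1. Proof. lra. Qed.

Let onem_half : 1 - 1 / 2 = 1 / 2 :> R. Proof. lra. Qed.

Let harmonic_mean x y : 2 * x * y / (x + y) = harmonic_segment x y (1 / 2).
Proof.
have -> : 2 * x * y / (x + y) = x * y / (2^-1 * (x + y)).
  by rewrite invfM invrK; ring.
by rewrite /harmonic_segment onem_half -mulrDr div1r.
Qed.

(** Symmetric points of a harmonic segment have the same harmonic mean as its
    end points. *)
Let harmonic_mean_segment x y t : a <= x <= b -> a <= y <= b -> 0 < t < 1 ->
  harmonic_segment (harmonic_segment x y t) (harmonic_segment x y (1 - t))
    (1 / 2) = 2 * x * y / (x + y).
Proof.
move=> xE yE t01; have [t01' s01] := itv01 t01.
have sE := itv_neq0 (harmonic_segment_in_itv ab_neq0 xE yE t01').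
have rE := itv_neq0 (harmonic_segment_in_itv ab_neq0 xE yE s01).
move: sE rE; rewrite /harmonic_segment subKr.
rewrite !mulf_eq0 !invr_eq0 !negb_or => /andP[/andP[x0 y0] d0] /andP[_ d1].
have xy0 : x + y != 0.
  have := itv_mul_gt0 ab_neq0 xE yE.
  by apply: contraTneq => /eqP; rewrite addr_eq0 => /eqP ->;
    rewrite mulNr oppr_gt0 -leNgt -expr2 sqr_ge0.
rewrite onem_half.
have -> : 1 / 2 * (x * y / (t * x + (1 - t) * y)) +
    1 / 2 * (x * y / ((1 - t) * x + t * y)) =
    1 / 2 * (x * y * (x + y)) /
    ((t * x + (1 - t) * y) * ((1 - t) * x + t * y)).
  by field; rewrite d0 d1.
by field; rewrite d0 d1 x0 y0 xy0.
Qed.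

Let symm_integrable x y : a <= x <= b -> a <= y <= b -> x != y ->
  lebesgue_integrable `[0, 1] (F \o harmonic_segment x y).
Proof.
by move=> xE yE xy; have [] := symm_mean_identity ab ab_neq0 xE yE xy f_int.
Qed.

Lemma symm_hermite_hadamard_convex x y :
  symm_harmonic_h_convex h a b f -> a <= x <= b -> a <= y <= b -> x != y ->
  F (2 * x * y / (x + y)) <=
    2 * h (1 / 2) * lebesgue_int (F \o harmonic_segment x y) 0 1 /\
  lebesgue_int (F \o harmonic_segment x y) 0 1 <=
    (F x + F y) * lebesgue_int h 0 1.
Proof.
move=> Fh xE yE xy.
apply: hermite_hadamard01 => //; first exact: symm_integrable.
  by move=> t t01; apply: Fh => //=; rewrite in_itv.
move=> t t01; have [t01' s01] := itv01 t01.
have sE := harmonic_segment_in_itv ab_neq0 xE yE t01'.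
have rE := harmonic_segment_in_itv ab_neq0 xE yE s01.
have FE : F (harmonic_segment (harmonic_segment x y t)
      (harmonic_segment x y (1 - t)) (1 / 2)) <=
    h (1 / 2) * F (harmonic_segment x y (1 - t)) +
    h (1 - 1 / 2) * F (harmonic_segment x y t) by exact: Fh.
move: FE; rewrite harmonic_mean_segment// onem_half => FE.
by rewrite mulrDr [X in _ <= X]addrC.
Qed.

Lemma symm_hermite_hadamard_concave x y :
  symm_harmonic_h_concave h a b f -> a <= x <= b -> a <= y <= b -> x != y ->
  2 * h (1 / 2) * lebesgue_int (F \o harmonic_segment x y) 0 1 <=
    F (2 * x * y / (x + y)) /\
  (F x + F y) * lebesgue_int h 0 1 <=
    lebesgue_int (F \o harmonic_segment x y) 0 1.
Proof.
move=> Fh xE yE xy.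
apply: hermite_hadamard01_concave => //; first exact: symm_integrable.
  by move=> t t01; apply: Fh => //=; rewrite in_itv.
move=> t t01; have [t01' s01] := itv01 t01.
have sE := harmonic_segment_in_itv ab_neq0 xE yE t01'.
have rE := harmonic_segment_in_itv ab_neq0 xE yE s01.
have FE : F (harmonic_segment (harmonic_segment x y t)
      (harmonic_segment x y (1 - t)) (1 / 2)) >=
    h (1 / 2) * F (harmonic_segment x y (1 - t)) +
    h (1 - 1 / 2) * F (harmonic_segment x y t) by exact: Fh.
move: FE; rewrite harmonic_mean_segment// onem_half => FE.
by rewrite mulrDr [X in X <= _]addrC.
Qed.

(** The second argument of [f] is the reflection of the harmonic mean of [x]
    and [y]. *)
Lemma symm_transform_harmonic_mean x y : a <= x <= b -> a <= y <= b ->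
  F (2 * x * y / (x + y)) =
  2^-1 * (f (2 * x * y / (x + y)) +
    f (2 * a * b * x * y / (2 * x * y * (a + b) - a * b * (x + y)))).
Proof.
move=> xE yE; rewrite /F /symm_transform; congr (_ * (_ + f _)).
have m01 : 0 <= (1 / 2 : R) <= 1 by lra.
have mE := harmonic_segment_in_itv ab_neq0 xE yE m01.
rewrite -harmonic_mean in mE.
have := lt0r_neq0 (harm_refl_den_gt0 ab ab_neq0 mE).
have := itv_neq0 mE; rewrite !mulf_eq0 invr_eq0 !negb_or => /andP[_ xy0].
have dE : (a + b) * (2 * x * y / (x + y)) - a * b =
    (2 * x * y * (a + b) - a * b * (x + y)) / (x + y) by field.
rewrite /harm_refl dE mulf_eq0 invr_eq0 negb_or => /andP[d0 _].
by field; rewrite d0 xy0.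
Qed.

End symmetrized_hermite_hadamard.

Theorem theorem5 (R : realType) (a b : R) (J : set R) (h f : R -> R)
    (ab : a < b)
    (ab_neq0 : `[a, b] `<=` [set t : R | t != 0])
    (J01 : `]0, 1[ `<=` J)
    (h_ge0 : forall t : R, J t -> 0 <= h t)
    (h_neq0 : exists t : R, J t /\ h t != 0)
    (h_int : lebesgue_integrable `[0, 1] h)
    (h_half : h (1 / 2) != 0)
    (f_ge0 : forall t : R, a <= t <= b -> 0 <= f t)
    (f_int : lebesgue_integrable `[a, b] f) :
  (symm_harmonic_h_convex h a b f ->
    (forall x y : R, a <= x <= b -> a <= y <= b -> x != y ->
      1 / (4 * h (1 / 2)) *
        (f (2 * x * y / (x + y)) +
         f (2 * a * b * x * y / (2 * x * y * (a + b) - a * b * (x + y))))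
      <= x * y / (2 * (y - x)) *
        (lebesgue_int (fun t => f t / t ^+ 2) x y +
         lebesgue_int (fun t => f t / t ^+ 2)
           (harm_refl a b y) (harm_refl a b x))
      <= 1 / 2 * (f x + f (harm_refl a b x) + f y + f (harm_refl a b y)) *
           lebesgue_int h 0 1) /\
    (1 / (2 * h (1 / 2)) * f (2 * a * b / (a + b))
      <= a * b / (b - a) * lebesgue_int (fun t => f t / t ^+ 2) a b
      <= (f a + f b) * lebesgue_int h 0 1)) /\
  (symm_harmonic_h_concave h a b f ->
    (forall x y : R, a <= x <= b -> a <= y <= b -> x != y ->
      1 / 2 * (f x + f (harm_refl a b x) + f y + f (harm_refl a b y)) *
        lebesgue_int h 0 1
      <= x * y / (2 * (y - x)) *
        (lebesgue_int (fun t => f t / t ^+ 2) x y +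
         lebesgue_int (fun t => f t / t ^+ 2)
           (harm_refl a b y) (harm_refl a b x))
      <= 1 / (4 * h (1 / 2)) *
        (f (2 * x * y / (x + y)) +
         f (2 * a * b * x * y / (2 * x * y * (a + b) - a * b * (x + y))))) /\
    ((f a + f b) * lebesgue_int h 0 1
      <= a * b / (b - a) * lebesgue_int (fun t => f t / t ^+ 2) a b
      <= 1 / (2 * h (1 / 2)) * f (2 * a * b / (a + b)))).
Proof.
have h_gt0 : 0 < h (1 / 2).
  by rewrite lt0r h_half h_ge0//; apply: J01; rewrite /= in_itv/=; lra.
have aE : a <= a <= b by rewrite lexx ltW.
have bE : a <= b <= b by rewrite lexx ltW.
have ab' : a != b by rewrite lt_eqF.
have a0 : a != 0 by apply: ab_neq0; rewrite /= in_itv.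
have b0 : b != 0 by apply: ab_neq0; rewrite /= in_itv.
have ab0 : a + b != 0.
  have := itv_mul_gt0 ab_neq0 aE bE.
  by apply: contraTneq => /eqP; rewrite addr_eq0 => /eqP ->;
    rewrite mulNr oppr_gt0 -leNgt -expr2 sqr_ge0.
have midE x y : a <= x <= b -> a <= y <= b ->
    1 / (4 * h (1 / 2)) * (f (2 * x * y / (x + y)) +
      f (2 * a * b * x * y / (2 * x * y * (a + b) - a * b * (x + y)))) =
    symm_transform a b f (2 * x * y / (x + y)) / (2 * h (1 / 2)).
  move=> xE yE; rewrite (symm_transform_harmonic_mean f ab ab_neq0 xE yE).
  by field; exact: h_half.
have endE x y H : 1 / 2 * (f x + f (harm_refl a b x) + f y +
      f (harm_refl a b y)) * H =
    (symm_transform a b f x + symm_transform a b f y) * H.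
  by rewrite /symm_transform; field.
have fixE : 2 * a * b * a * b / (2 * a * b * (a + b) - a * b * (a + b)) =
    2 * a * b / (a + b).
  have -> : 2 * a * b * (a + b) - a * b * (a + b) = a * b * (a + b) by ring.
  by field; rewrite a0 b0 ab0.
have midabE : 1 / (2 * h (1 / 2)) * f (2 * a * b / (a + b)) =
    1 / (4 * h (1 / 2)) * (f (2 * a * b / (a + b)) +
      f (2 * a * b * a * b / (2 * a * b * (a + b) - a * b * (a + b)))).
  by rewrite fixE; field; exact: h_half.
have intabE : a * b / (b - a) * lebesgue_int (fun t => f t / t ^+ 2) a b =
    a * b / (2 * (b - a)) * (lebesgue_int (fun t => f t / t ^+ 2) a b +
      lebesgue_int (fun t => f t / t ^+ 2) (harm_refl a b b) (harm_refl a b a)).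
  rewrite (harm_refl_left ab ab_neq0) (harm_refl_right ab ab_neq0); field.
  by rewrite subr_eq0 eq_sym.
have endabE : (f a + f b) * lebesgue_int h 0 1 =
    1 / 2 * (f a + f (harm_refl a b a) + f b + f (harm_refl a b b)) *
      lebesgue_int h 0 1.
  by rewrite (harm_refl_left ab ab_neq0) (harm_refl_right ab ab_neq0); field.
(* the inequalities for [a, b] are those for [x, y] at [x = a], [y = b] *)
have conj_from (P Q : Prop) : P -> (P -> Q) -> P /\ Q by move=> p; split; auto.
split=> Fh; apply: conj_from => [x y xE yE xy|bounds].
- have [lb ub] :=
    symm_hermite_hadamard_convex ab ab_neq0 h_int f_int Fh xE yE xy.
  have [_ ->] := symm_mean_identity ab ab_neq0 xE yE xy f_int.
  by rewrite midE// endE ub andbT ler_pdivrMr ?mulr_gt0// [leRHS]mulrC.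
- by rewrite midabE intabE endabE; exact: bounds.
- have [ub lb] :=
    symm_hermite_hadamard_concave ab ab_neq0 h_int f_int Fh xE yE xy.
  have [_ ->] := symm_mean_identity ab ab_neq0 xE yE xy f_int.
  by rewrite midE// endE lb /= ler_pdivlMr ?mulr_gt0// [leLHS]mulrC.
- by rewrite midabE intabE endabE; exact: bounds.
Qed.
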